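(* Let $\mathcal G$ be a connected, undirected, edge-weighted, time-scaled graph with time scales $\epsilon_1,\dots,\epsilon_n>0$ and spanning tree $\mathcal T\subseteq\mathcal G$, with the edge consensus dynamics $\Sigma^{\mathcal T}[\mathcal G]$. Consider adding an edge $ij$ (not in $\mathcal G$) to $\mathcal G$ to get $\mathcal G\cup\{ij\}$. Then the time-scale term of the squared $\mathcal H_2$ norm satisfies $$\mathcal H_2^2(\Sigma^{\mathcal T}[\mathcal G\cup\{ij\}];E)=\frac{\sigma_v^2}{2}\left(\epsilon_i^{-1}+\epsilon_j^{-1}\right)+\mathcal H_2^2(\Sigma^{\mathcal T}[\mathcal G];E).$$
   Context: For an undirected graph $\mathcal G$ on $\{1,\dots,n\}$ with edge weights $w_{ij}>0$ and time scales $\epsilon_i>0$, $D_{\mathcal G}$ denotes the incidence matrix: the column of edge $ij$ has $1$ in one of the positions $i,j$ and $-1$ in the other (orientation arbitrary) and zeros elsewhere. $W_{\mathcal G}$ is the diagonal matrix of edge weights, and $E=\mathrm{diag}(\epsilon_1,\dots,\epsilon_n)$. For a spanning tree $\mathcal T\subseteq\mathcal G$, $D_{\mathcal T}$ and $D_{\mathcal G\setminus\mathcal T}$ are the incidence matrices of the edges in $\mathcal T$ and of the edges of $\mathcal G$ not in $\mathcal T$; $T_{\mathcal T}=(D_{\mathcal T}^\top D_{\mathcal T})^{-1}D_{\mathcal T}^\top D_{\mathcal G\setminus\mathcal T}$; $R_{\mathcal G}=[\,I\;\;T_{\mathcal T}\,]$ (with $R_{\mathcal G}=I$ if $\mathcal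 G=\mathcal T$), columns of $D_{\mathcal G}$ and $W_{\mathcal G}$ being ordered with tree edges first. The edge Laplacian is $\mathcal L^{\mathcal T}=D_{\mathcal T}^\top E^{-1}D_{\mathcal T}$. The system $\Sigma^{\mathcal T}[\mathcal G]$ is $$\dot x_{\mathcal T}=-\mathcal L^{\mathcal T}R_{\mathcal G}W_{\mathcal G}R_{\mathcal G}^\top x_{\mathcal T}+D_{\mathcal T}^\top E^{-1}\omega-\mathcal L^{\mathcal T}R_{\mathcal G}v,\qquad z=R_{\mathcal G}^\top x_{\mathcal T},$$ with independent zero-mean Gaussian white noises $\omega,v$ of covariances $\Omega^2,\Gamma^2$, where $\Omega=\sigma_\omega E^{1/2}$, $\Gamma=\sigma_vW_{\mathcal G}^{1/2}$, and $\sigma_\omega,\sigma_v>0$. Its squared $\mathcal H_2$ norm is $\mathcal H_2^2(\Sigma^{\mathcal T}[\mathcal G])=\mathcal H_2^2(\Sigma^{\mathcal T}[\mathcal G];W)+\mathcal H_2^2(\Sigma^{\mathcal T}[\mathcal G];E)$, where $$\mathcal H_2^2(\Sigma^{\mathcal T}[\mathcal G];W)=\frac{\sigma_\omega^2}{2}\mathbf{tr}\left[R_{\mathcal G}^\top(R_{\mathcal G}W_{\mathcal G}R_{\mathcal G}^\top)^{-1}R_{\mathcal G}\right],\qquad \mathcal H_2^2(\Sigma^{\mathcal T}[\mathcal G];E)=\frac{\sigma_v^2}{2}\mathbf{tr}\left[R_{\mathcal G}^\top\mathcal L^{\mathcal T}R_{\mathcal G}\right].$$ The same spanning tree $\mathcal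 T$ is used for $\mathcal G$ and $\mathcal G\cup\{ij\}$. *)

(* Defs.v *)
From HB Require Import structures.
From mathcomp Require Import all_boot all_order all_algebra.

Set Implicit Arguments.
Unset Strict Implicit.
Unset Printing Implicit Defensive.

Import Order.TTheory GRing.Theory Num.Theory.
Local Open Scope ring_scope.

(* An undirected edge is the set of its two endpoints; the weight function is
   only meaningful on edges. *)
Record ts_graph (R : realFieldType) (n : nat) := TsGraph {
  edges : {set {set 'I_n}};
  edges_card2 : forall e, e \in edges -> #|e| = 2;
  weight : {set 'I_n} -> R;
  weight_gt0 : forall e, e \in edges -> 0 < weight e;
  scale : 'I_n -> R;
  scale_gt0 : forall i, 0 < scale i
}.

Section EdgeSets.
Variable n : nat.
Implicit Types A T : {set {set 'I_n}}.

Definition adj A : rel 'I_n := [rel u v | [set u; v] \in A].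

Definition connected A : Prop := forall u v, connect (adj A) u v.

(* The bound on the size excludes going back and forth along one edge. *)
Definition acyclic A : Prop :=
  forall c : seq 'I_n, (2 < size c)%N -> ~~ ucycleb (adj A) c.

Definition spanning_tree A T : Prop :=
  [/\ T \subset A, connected T & acyclic T].

Definition edge_of (p : 'I_n * 'I_n) : {set 'I_n} := [set p.1; p.2].

(* An arbitrary orientation of the edges of A together with an arbitrary
   numbering of them in which the edges of T come first: each edge of T occurs
   exactly once in tree_arcs, each remaining edge of A once in cotree_arcs. *)
Record tree_first_arcs A T := TreeFirstArcs {
  tree_arcs : #|T|.-tuple ('I_n * 'I_n);
  tree_arcsP : perm_eq (map edge_of tree_arcs) (enum T);
  cotree_arcs : #|A :\: T|.-tuple ('I_n * 'I_n);
  cotree_arcsP : perm_eq (map edge_of cotree_arcs) (enum (A :\: T))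
}.

End EdgeSets.

Section AddEdge.
Variables (R : realFieldType) (n : nat) (G : ts_graph R n).
Variables (i j : 'I_n) (neq_ij : i != j) (w : R) (w_gt0 : 0 < w).

Let edges' := [set i; j] |: edges G.
Let weight' e := if e == [set i; j] then w else weight G e.

Fact add_edge_card2 e : e \in edges' -> #|e| = 2.
Proof.
by case/setU1P=> [->|/edges_card2 //]; rewrite cards2 neq_ij.
Qed.

Fact add_edge_weight_gt0 e : e \in edges' -> 0 < weight' e.
Proof.
by rewrite /weight'; case: eqP => // ne /setU1P[//|]; apply: weight_gt0.
Qed.

Definition add_edge : ts_graph R n :=
  TsGraph add_edge_card2 add_edge_weight_gt0 (@scale_gt0 R n G).

End AddEdge.

Definition incidence (R : realFieldType) (n m : nat)
    (t : m.-tuple ('I_n * 'I_n)) : 'M[R]_(n, m) :=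
  \matrix_(k < n, e < m)
    ((k == (tnth t e).1)%:R - (k == (tnth t e).2)%:R).

Section EdgeConsensus.
Variables (R : realFieldType) (n : nat) (G : ts_graph R n).
Variables (T : {set {set 'I_n}}) (arcs : tree_first_arcs (edges G) T).

Definition tree_incidence : 'M[R]_(n, #|T|) := incidence R (tree_arcs arcs).

Definition cotree_incidence : 'M[R]_(n, #|edges G :\: T|) :=
  incidence R (cotree_arcs arcs).

Definition scale_mx : 'M[R]_n := diag_mx (\row_k scale G k).

Definition weight_mx : 'M[R]_(#|T| + #|edges G :\: T|) :=
  diag_mx (row_mx (\row_e weight G (edge_of (tnth (tree_arcs arcs) e)))
                  (\row_e weight G (edge_of (tnth (cotree_arcs arcs) e)))).

Definition cotree_coeff_mx : 'M[R]_(#|T|, #|edges G :\: T|) :=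
  invmx (tree_incidence^T *m tree_incidence)
    *m tree_incidence^T *m cotree_incidence.

(* If T is all of edges G, the right block has no columns and this is I. *)
Definition cut_mx : 'M[R]_(#|T|, #|T| + #|edges G :\: T|) :=
  row_mx 1%:M cotree_coeff_mx.

Definition edge_laplacian : 'M[R]_#|T| :=
  tree_incidence^T *m invmx scale_mx *m tree_incidence.

(* For the edge consensus dynamics
     x' = - L R W R^T x + D_T^T E^-1 omega - L R v,   z = R^T x
   (L, R, W, D_T, E being edge_laplacian, cut_mx, weight_mx, tree_incidence
   and scale_mx) driven by white noises omega and v of covariances
   sigma_omega^2 E and sigma_v^2 W, the squared H2 norm from (omega, v) to z is
   h2_sqr, the sum of an edge-weight term and a time-scale term. *)
Definition h2_sqr_weight (sigma_omega : R) : R :=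
  sigma_omega ^+ 2 / 2
    * \tr (cut_mx^T *m invmx (cut_mx *m weight_mx *m cut_mx^T) *m cut_mx).

Definition h2_sqr_scale (sigma_v : R) : R :=
  sigma_v ^+ 2 / 2 * \tr (cut_mx^T *m edge_laplacian *m cut_mx).

Definition h2_sqr (sigma_omega sigma_v : R) : R :=
  h2_sqr_weight sigma_omega + h2_sqr_scale sigma_v.

End EdgeConsensus.

(* Main.v *)
Require Import Defs.
From HB Require Import structures.
From mathcomp Require Import all_boot all_order all_algebra.

Set Implicit Arguments.
Unset Strict Implicit.
Unset Printing Implicit Defensive.

Import Order.TTheory GRing.Theory Num.Theory.
Local Open Scope ring_scope.

(** Everything rests on the identity D_T R = [D_T D_C], where D_T and D_C are
    the incidence matrices of the tree and of the remaining edges.  It turns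
    tr (R^T D_T^T E^-1 D_T R) into tr (D^T E^-1 D) for the full incidence matrix
    D, and the diagonal entry of D^T E^-1 D at an edge ab is
    1/eps_a + 1/eps_b.  Hence the time-scale term is sigma_v^2/2 times a sum
    over all edges of the graph (h2_sqr_scaleE), in which neither the tree nor
    the weights nor the numbering and orientation of the edges survive; a new
    edge ij contributes exactly its own summand.

    The identity uses both halves of the definition of a spanning tree.
    - T is acyclic, so D_T has a left inverse (incidence_left_inverse): for an
      edge e = uv of T, the indicator of the component of u in T - e is a
      potential whose difference is 1 along e and 0 along all other edges of T.
      Therefore D_T^T D_T is invertible and the inverse in the definition of
      the matrix R is a genuine one.
    - T is connected, so telescoping along a path of T shows that the column of
      any arc is a combination of the columns of D_T (arc_sub_incidence);
      D_T (D_T^T D_T)^-1 D_T^T fixes such columns. *)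

(** * Bridges of acyclic graphs and numberings of edges *)

Section EdgeSets.
Variable n : nat.
Implicit Types A T : {set {set 'I_n}}.

Lemma adj_sym A : symmetric (adj A).
Proof. by move=> u v; rewrite /adj /= setUC. Qed.

Lemma adj_connect_sym A : connect_sym (adj A).
Proof. exact/sym_connect_sym/adj_sym. Qed.

(** A simple path joining u and v outside the edge uv has at least three
    vertices, so the edge closes it into a forbidden cycle. *)
Lemma acyclic_bridge T (u v : 'I_n) : acyclic T -> [set u; v] \in T ->
  u != v -> ~~ connect (adj (T :\ [set u; v])) u v.
Proof.
move=> acT uvT neq_uv; apply/negP => /connectP[p0 p0P].
case/shortenP: p0P => p pathp uniq_p _ def_v.
have p_gt1 : (1 < size p)%N.
  case: p pathp def_v {uniq_p} => [_ /= def_v|x [|//] /=].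
    by rewrite def_v eqxx in neq_uv.
  by rewrite /adj /= => + def_v; rewrite -def_v setD11.
case/negP: (acT (u :: p) p_gt1); rewrite /ucycleb uniq_p andbT /=.
rewrite rcons_path -def_v adj_sym [adj T u v]uvT andbT.
by apply: sub_path pathp => x y /setD1P[].
Qed.

Lemma card_edge_of (p : 'I_n * 'I_n) : (#|edge_of p| == 2)%N = (p.1 != p.2).
Proof. by rewrite cards2 eqSS eqb1. Qed.

Section Numbering.
Variables (T : {set {set 'I_n}}) (m : nat) (t : m.-tuple ('I_n * 'I_n)).
Hypothesis tP : perm_eq (map (@edge_of n) t) (enum T).

Lemma edge_of_tnth (a : 'I_m) : edge_of (tnth t a) \in T.
Proof. by rewrite -mem_enum -(perm_mem tP) map_f ?mem_tnth. Qed.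

Lemma edge_of_tnth_inj : injective (fun a : 'I_m => edge_of (tnth t a)).
Proof.
move=> a b; pose s := map_tuple (@edge_of n) t => eq_ab.
have uniq_s : uniq s by rewrite (perm_uniq tP) enum_uniq.
by apply: (tuple_uniqP s uniq_s); rewrite !tnth_map.
Qed.

Lemma edge_of_tnth_surj (e : {set 'I_n}) : e \in T ->
  exists a : 'I_m, e = edge_of (tnth t a).
Proof.
rewrite -mem_enum -(perm_mem tP) => /mapP[p /tnthP[a ->] ->].
by exists a.
Qed.

Lemma sum_numbering (V : nmodType) (f : {set 'I_n} -> V) :
  \sum_(a < m) f (edge_of (tnth t a)) = \sum_(e in T) f e.
Proof.
rewrite -(big_tuple _ _ t xpredT (fun p => f (edge_of p))) -big_enum /=.
by rewrite -(perm_big _ tP) big_map.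
Qed.

End Numbering.
End EdgeSets.

(** * Incidence matrices *)

Section Incidence.
Variables (R : realFieldType) (n : nat).
Implicit Types T : {set {set 'I_n}}.

Definition arc_row (u v : 'I_n) : 'rV[R]_n := delta_mx 0 u - delta_mx 0 v.

Lemma row_incidenceT m (t : m.-tuple ('I_n * 'I_n)) (a : 'I_m) :
  row a (incidence R t)^T = arc_row (tnth t a).1 (tnth t a).2.
Proof. by apply/rowP=> k; rewrite !mxE. Qed.

Lemma mul_incidence l m (F : 'M[R]_(l, n)) (t : m.-tuple ('I_n * 'I_n)) b a :
  (F *m incidence R t) b a = F b (tnth t a).1 - F b (tnth t a).2.
Proof.
have pick (u : 'I_n) : \sum_k F b k * (k == u)%:R = F b u.
  rewrite (bigD1 u) //= eqxx mulr1 big1 ?addr0 // => k /negPf->.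
  exact: mulr0.
rewrite mxE; under eq_bigr => k _ do rewrite mxE mulrBr.
by rewrite sumrB !pick.
Qed.

(** Row a of F is the indicator of the component of the tail of arc a in T
    without the edge of that arc: this edge is a bridge, so the indicator drops
    from 1 to 0 along it, while any other edge of T lies inside one
    component. *)
Lemma incidence_left_inverse T m (t : m.-tuple ('I_n * 'I_n)) :
    acyclic T -> (forall e, e \in T -> #|e| = 2) ->
    perm_eq (map (@edge_of n) t) (enum T) ->
  exists F : 'M[R]_(m, n), F *m incidence R t = 1%:M.
Proof.
move=> acT card2T tP.
pose comp a := connect (adj (T :\ edge_of (tnth t a))) (tnth t a).1.
exists (\matrix_(a, k) (comp a k)%:R); apply/matrixP=> b a.
rewrite mul_incidence !mxE; have [<-|neq_ba] := eqVneq b a.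
  have bT := edge_of_tnth tP b.
  have neq_ends : (tnth t b).1 != (tnth t b).2.
    by rewrite -card_edge_of card2T.
  by rewrite /comp connect0 (negPf (acyclic_bridge acT bT neq_ends)) subr0.
have adj_a : adj (T :\ edge_of (tnth t b)) (tnth t a).1 (tnth t a).2.
  rewrite /adj /= in_setD1 [_ \in T](edge_of_tnth tP) andbT.
  by apply: contra_neq neq_ba => /(edge_of_tnth_inj tP).
rewrite /comp (same_connect_r (@adj_connect_sym _ _) (connect1 adj_a)).
exact: subrr.
Qed.

Lemma arc_sub_incidence T m (t : m.-tuple ('I_n * 'I_n)) (u v : 'I_n) :
    perm_eq (map (@edge_of n) t) (enum T) -> connect (adj T) u v ->
  (arc_row u v <= (incidence R t)^T)%MS.
Proof.
move=> tP /connectP[p]; elim: p u => [|x p IHp] u /=.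
  by move=> _ ->; rewrite /arc_row subrr sub0mx.
case/andP=> /(edge_of_tnth_surj tP)[a def_a] pathp def_v.
have -> : arc_row u v = arc_row u x + arc_row x v.
  by rewrite /arc_row addrA subrK.
apply: addmx_sub (IHp x pathp def_v).
have := row_sub a (incidence R t)^T; rewrite row_incidenceT.
(* The orientation of arc a is arbitrary, so it runs along ux or along xu. *)
move: def_a; case: (tnth t a) => y z; rewrite /edge_of /= => def_a.
have [def_uv|def_uv] : (u = y /\ x = z) \/ (u = z /\ x = y).
  have : u \in [set y; z] by rewrite -def_a set21.
  have : x \in [set y; z] by rewrite -def_a set22.
  have : y \in [set u; x] by rewrite def_a set21.
  have : z \in [set u; x] by rewrite def_a set22.
  rewrite !inE; do 4!case/orP=> /eqP ?; subst; by [left|right].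
- by case: def_uv => -> ->.
- case: def_uv => -> ->; rewrite -[in X in _ -> X]eqmx_opp.
  by rewrite /arc_row opprB.
Qed.

(** Over a real field x D^T D = 0 forces the sum of squares x D^T D x^T of
    the entries of x D^T, hence x D^T itself, to vanish; then x = x (F D)^T = 0. *)
Lemma gram_unitmx m (D : 'M[R]_(n, m)) (F : 'M[R]_(m, n)) :
  F *m D = 1%:M -> D^T *m D \in unitmx.
Proof.
move=> FD1; rewrite -row_free_unit; apply/inj_row_free => x xG0.
have xD0 : x *m D^T = 0.
  set y := x *m D^T.
  have y2 : \sum_k y 0 k ^+ 2 = 0.
    have : (y *m y^T) 0 0 = 0.
      by rewrite {2}/y trmx_mul trmxK mulmxA -(mulmxA x) xG0 mul0mx mxE.
    by rewrite mxE; apply: etrans; apply: eq_bigr => k _; rewrite [y^T _ _]mxE expr2.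
  apply/rowP=> k; rewrite [RHS]mxE; apply/eqP; rewrite -sqrf_eq0.
  by move/psumr_eq0P: y2 => -> // l _; rewrite sqr_ge0.
have : x *m (F *m D)^T = 0 by rewrite trmx_mul mulmxA xD0 mul0mx.
by rewrite FD1 trmx1 mulmx1.
Qed.

(** The squared entries of an incidence column are the indicator of the
    two ends. *)
Lemma tr_incidence_diag T m (t : m.-tuple ('I_n * 'I_n)) (d : 'I_n -> R) :
    (forall e, e \in T -> #|e| = 2) ->
    perm_eq (map (@edge_of n) t) (enum T) ->
  \tr ((incidence R t)^T *m diag_mx (\row_k d k) *m incidence R t)
    = \sum_(e in T) \sum_(k in e) d k.
Proof.
move=> card2T tP; rewrite -(sum_numbering tP); apply: eq_bigr => a _.
have neq_ends : (tnth t a).1 != (tnth t a).2.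
  by rewrite -card_edge_of card2T ?(edge_of_tnth tP).
rewrite mul_incidence !mul_mx_diag !mxE /edge_of big_setU1 ?inE //= big_set1.
rewrite !eqxx (negPf neq_ends) [_ == (tnth t a).1]eq_sym (negPf neq_ends).
by rewrite subr0 sub0r mul1r mulN1r opprK.
Qed.

End Incidence.

(** * The time-scale term *)

Section ScaleTerm.
Variables (R : realFieldType) (n : nat) (G : ts_graph R n).
Variables (T : {set {set 'I_n}}) (T_tree : spanning_tree (edges G) T).
Variable arcs : tree_first_arcs (edges G) T.

Lemma tree_card2 e : e \in T -> #|e| = 2.
Proof. by case: T_tree => /subsetP sTG _ _ /sTG/edges_card2. Qed.

Lemma cotree_card2 e : e \in edges G :\: T -> #|e| = 2.
Proof. by case/setDP=> /edges_card2. Qed.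

(** D_T (D_T^T D_T)^-1 D_T^T is the projection onto the range of D_T, which
    contains the columns of the other edges because T is connected. *)
Lemma tree_mul_cut_mx :
  tree_incidence arcs *m cut_mx arcs
    = row_mx (tree_incidence arcs) (cotree_incidence arcs).
Proof.
case: T_tree => _ connT acT.
have [F FD1] := incidence_left_inverse R acT tree_card2 (tree_arcsP arcs).
rewrite mul_mx_row mulmx1; congr row_mx.
have /submxP[Y defC] : ((cotree_incidence arcs)^T <= (tree_incidence arcs)^T)%MS.
  apply/row_subP=> a; rewrite row_incidenceT.
  exact: arc_sub_incidence (tree_arcsP arcs) (connT _ _).
have {}defC : cotree_incidence arcs = tree_incidence arcs *m Y^T.
  by rewrite -[LHS]trmxK defC trmx_mul trmxK.
rewrite /cotree_coeff_mx defC -(mulmxA (invmx _)) (mulmxA _^T).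
by rewrite mulKmx ?(gram_unitmx FD1).
Qed.

Lemma invmx_scale_mx : invmx (scale_mx G) = diag_mx (\row_k (scale G k)^-1).
Proof.
have scaleV : scale_mx G *m diag_mx (\row_k (scale G k)^-1) = 1%:M.
  apply/matrixP=> k l; rewrite mul_diag_mx !mxE.
  case: eqVneq => [->|_]; last by rewrite mulr0n mulr0.
  by rewrite !mulr1n divff // gt_eqF ?scale_gt0.
have [scale_unit _] := mulmx1_unit scaleV.
by rewrite -[LHS]mulmx1 -scaleV mulKmx.
Qed.

Lemma h2_sqr_scaleE sigma_v :
  h2_sqr_scale arcs sigma_v
    = sigma_v ^+ 2 / 2 * \sum_(e in edges G) \sum_(k in e) (scale G k)^-1.
Proof.
have [sTG _ _] := T_tree; congr (_ * _).
have -> : (cut_mx arcs)^T *m edge_laplacian arcs *m cut_mx arcs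
    = (tree_incidence arcs *m cut_mx arcs)^T *m invmx (scale_mx G)
        *m (tree_incidence arcs *m cut_mx arcs).
  by rewrite trmx_mul /edge_laplacian !mulmxA.
rewrite tree_mul_cut_mx tr_row_mx mul_col_mx mul_col_row mxtrace_block.
rewrite invmx_scale_mx (tr_incidence_diag _ tree_card2 (tree_arcsP arcs)).
rewrite (tr_incidence_diag _ cotree_card2 (cotree_arcsP arcs)).
by rewrite [RHS](big_setID T) /= (setIidPr sTG).
Qed.

End ScaleTerm.

Theorem corollary7 (R : realFieldType) (n : nat) (G : ts_graph R n)
    (G_connected : connected (edges G))
    (T : {set {set 'I_n}}) (T_tree : spanning_tree (edges G) T)
    (i j : 'I_n) (neq_ij : i != j) (ij_notin_G : [set i; j] \notin edges G)
    (w : R) (w_gt0 : 0 < w)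
    (sigma_omega sigma_v : R)
    (sigma_omega_gt0 : 0 < sigma_omega) (sigma_v_gt0 : 0 < sigma_v)
    (arcs : tree_first_arcs (edges G) T)
    (arcs' : tree_first_arcs (edges (add_edge G neq_ij w_gt0)) T) :
  h2_sqr_scale arcs' sigma_v =
    sigma_v ^+ 2 / 2 * ((scale G i)^-1 + (scale G j)^-1)
    + h2_sqr_scale arcs sigma_v.
Proof.
have T_tree' : spanning_tree (edges (add_edge G neq_ij w_gt0)) T.
  case: T_tree => sTG connT acT; split=> //.
  exact: subset_trans sTG (subsetUr _ _).
rewrite (h2_sqr_scaleE T_tree') (h2_sqr_scaleE T_tree) -mulrDr.
rewrite [edges (add_edge _ _ _)]/= big_setU1 //=.
by rewrite big_setU1 ?inE //= big_set1.
Qed.
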